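(* Let $\mathcal{M}\in\{\mathcal{P}_n,\mathcal{B}_n,\mathcal{S}_n\}$ and let $\operatorname{Exp}_x$ be the corresponding e-exponential map given in the context. Then $R_x:=\operatorname{Exp}_x$ is a retraction, i.e. $R_x\colon T_x\mathcal{M}\to\mathcal{M}$ satisfies, for all $x\in\mathcal{M}$, $$R_x(0)=x\quad(0\in T_x\mathcal{M}),\qquad dR_x(0)=\mathrm{id}_{T_x\mathcal{M}}.$$
   Context: Notation: $\mathbf{1}$ is the all-ones vector; $e^{(\cdot)}$, products $x\cdot z$ and quotients of vectors are componentwise; $\langle\cdot,\cdot\rangle$ is the Euclidean inner product. $\mathcal{P}_n=\mathbb{R}^n_{++}$ with $T_x\mathcal{P}_n=\mathbb{R}^n$; $\mathcal{B}_n=(0,1)^n$ with $T_x\mathcal{B}_n=\mathbb{R}^n$; $\mathcal{S}_n=\{p\in\mathbb{R}^n: p_i>0\ \forall i,\ \langle\mathbf{1},p\rangle=1\}$ with $T_x\mathcal{S}_n=\{v\in\mathbb{R}^n:\langle\mathbf{1},v\rangle=0\}$. For $v\in T_x\mathcal{M}$: $\mathcal{P}_n$: $\operatorname{Exp}_x(v)=x\cdot e^{v/x}$; $\mathcal{B}_n$: $\operatorname{Exp}_x(v)=\dfrac{x\cdot e^{v/(x\cdot(\mathbf{1}-x))}}{\mathbf{1}-x+x\cdot e^{v/(x\cdot(\mathbf{1}-x))}}$; $\mathcal{S}_n$: $\operatorname{Exp}_x(v)=\dfrac{x\cdot e^{v/x}}{\langle x,e^{v/x}\rangle}$. $dR_x(0)$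 is the differential of the map $R_x$ at $0\in T_x\mathcal{M}$, with $T_0(T_x\mathcal{M})$ identified with $T_x\mathcal{M}$. *)

(* Defs.v *)
From HB Require Import structures.
From mathcomp Require Import all_boot all_order all_algebra.
From mathcomp Require Import all_classical all_reals all_analysis.

Set Implicit Arguments.
Unset Strict Implicit.
Unset Printing Implicit Defensive.

Import Order.TTheory GRing.Theory Num.Theory.
Import numFieldNormedType.Exports.

Local Open Scope classical_set_scope.
Local Open Scope ring_scope.

Variant emanifold := Orthant | Box | Simplex.

Section EManifolds.
Context {R : realType} {n : nat}.
Implicit Types (M : emanifold) (x u v : 'rV[R]_n).

Definition ones : 'rV[R]_n := const_mx 1.

Definition dotv u v : R := \sum_i u 0 i * v 0 i.

Definition points M : set 'rV[R]_n :=
  match M with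
  | Orthant => [set p : 'rV[R]_n | forall i, 0 < p 0 i]
  | Box => [set p : 'rV[R]_n | forall i, 0 < p 0 i < 1]
  | Simplex => [set p : 'rV[R]_n | (forall i, 0 < p 0 i) /\ dotv ones p = 1]
  end.

(* In all three cases T_x M, as a subspace of R^n, does not depend on x. *)
Definition tangent_pred M : {pred 'rV[R]_n} :=
  fun v => if M is Simplex then dotv ones v == 0 else true.

Lemma tangent_submod M : GRing.submod_closed (tangent_pred M).
Proof.
split=> [|a u v]; rewrite !unfold_in; case: M => //.
  by rewrite /dotv big1// => i _; rewrite !mxE mulr0.
move=> /eqP u0 /eqP v0.
have -> : dotv ones (a *: u + v) = a * dotv ones u + dotv ones v.
  rewrite /dotv mulr_sumr -big_split/=; apply: eq_bigr => i _.
  by rewrite !mxE !mul1r.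
by rewrite u0 v0 mulr0 addr0.
Qed.

HB.instance Definition _ M :=
  GRing.isSubmodClosed.Build R 'rV[R]_n (tangent_pred M) (tangent_submod M).

Record tangent M := Tangent {
  tangent_val :> 'rV[R]_n;
  tangent_valP : tangent_val \in tangent_pred M
}.

HB.instance Definition _ M := [isSub for @tangent_val M].
HB.instance Definition _ M := [Choice of tangent M by <:].
HB.instance Definition _ M := [SubChoice_isSubLmodule of tangent M by <:].

(* The norm induced by that of 'rV[R]_n (the sup norm, equivalent to the
   Euclidean one); it makes the library's differential available on T_x M. *)
Definition tangent_norm M (v : tangent M) : R := `|tangent_val v|.

Lemma tangent_normD M (u v : tangent M) :
  tangent_norm (u + v) <= tangent_norm u + tangent_norm v.
Proof. exact: ler_normD. Qed.

Lemma tangent_normZ M (a : R) (v : tangent M) :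
  tangent_norm (a *: v) = `|a| * tangent_norm v.
Proof. exact: normrZ. Qed.

Lemma tangent_norm0_eq0 M (v : tangent M) : tangent_norm v = 0 -> v = 0.
Proof. by move/normr0_eq0 => v0; exact: val_inj. Qed.

HB.instance Definition _ M := Lmodule_isNormed.Build R (tangent M)
  (@tangent_normD M) (@tangent_normZ M) (@tangent_norm0_eq0 M).

Definition eExp M x (v : tangent M) : 'rV[R]_n :=
  match M with
  | Orthant => \row_i (x 0 i * expR (v 0 i / x 0 i))
  | Box =>
      let e := \row_i expR (v 0 i / (x 0 i * (1 - x 0 i))) : 'rV[R]_n in
      \row_i (x 0 i * e 0 i / (1 - x 0 i + x 0 i * e 0 i))
  | Simplex =>
      let e := \row_i expR (v 0 i / x 0 i) : 'rV[R]_n in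
      \row_i (x 0 i * e 0 i / dotv x e)
  end.

(* dR_x(0) has values in the ambient R^n, so that "dR_x(0) is the identity"
   reads: dR_x(0) is the inclusion of T_x M in R^n. *)
Definition is_retraction M (Rt : 'rV[R]_n -> tangent M -> 'rV[R]_n) : Prop :=
  forall x, points M x ->
    [/\ forall v : tangent M, points M (Rt x v),
        Rt x 0 = x,
        differentiable (Rt x) (0 : tangent M)
      & forall v : tangent M, 'd (Rt x) (0 : tangent M) v = tangent_val v].

End EManifolds.

Arguments tangent R n M : clear implicits.
Arguments eExp {R n} M x v.
Arguments is_retraction {R n} M Rt.

(* Main.v *)
From HB Require Import structures.
Require Import Defs.
From mathcomp Require Import all_boot all_order all_algebra.
From mathcomp Require Import all_classical all_reals all_analysis.
From mathcomp Require Import ring.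

(** All three exponentials are built from the scalar functions
    [a * exp (v_i / c)] of one coordinate, so their differentials at [0] come
    from the chain, sum and quotient rules, one coordinate at a time: a
    vector-valued map is differentiable as soon as its coordinates are
    ([is_diff_row]).

    For the orthant, [a = c = x_i] gives the differential [v_i] at once.  For
    the box and the simplex the coordinate is a quotient whose denominator is
    [1] at [v = 0], so the quotient rule reads [df - f 0 * dg]
    ([is_diff_div1]).  On the box this is
    [v_i / (1 - x_i) - x_i * (v_i / (1 - x_i)) = v_i].  On the simplex the
    differential of the normalizing denominator [<x, e^(v/x)>] is
    [sum_j v_j], which vanishes precisely because [v] is tangent; what is left
    is the differential [v_i] of the numerator.

    That the values lie in the manifold is positivity of the exponential,
    together with, on the simplex, the normalization of the quotients. *)

Set Implicit Arguments.
Unset Strict Implicit.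
Unset Printing Implicit Defensive.

Import Order.TTheory GRing.Theory Num.Theory.
Import numFieldNormedType.Exports.

Local Open Scope classical_set_scope.
Local Open Scope ring_scope.

Section Differentials.
Context {R : realType} {V : normedModType R}.

Lemma is_diff_bigsum (W : normedModType R) (I : Type) (s : seq I)
    (f df : I -> V -> W) (a : V) :
  (forall i, is_diff a (f i) (df i)) ->
  is_diff a (fun v => \sum_(i <- s) f i v) (fun v => \sum_(i <- s) df i v).
Proof.
move=> fdf; elim: s => [|i s IHs].
  under eq_fun do rewrite big_nil.
  under [X in is_diff _ _ X]eq_fun do rewrite big_nil.
  exact: is_diff_cst.
under eq_fun do rewrite big_cons.
under [X in is_diff _ _ X]eq_fun do rewrite big_cons.
exact: (is_diffD (fdf i) IHs).
Qed.

(** A row vector is the sum of its coordinates times the canonical basis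
    vectors, and scaling a fixed vector is linear and continuous. *)
Lemma is_diff_row n (f df : V -> 'rV[R]_n) (a : V) :
  (forall i, is_diff a (fun v => f v 0 i) (fun v => df v 0 i)) ->
  is_diff a f df.
Proof.
move=> fdf.
have rowE (g : V -> 'rV[R]_n) :
    g = fun v => \sum_(i < n) g v 0 i *: delta_mx 0 i.
  by apply/funext => v; rewrite -row_sum_delta.
rewrite (rowE f) (rowE df); apply: is_diff_bigsum => i.
have [fi dfi] := fdf i.
apply: DiffDef; first exact: differentiableZl.
by rewrite diffZl// dfi.
Qed.

Lemma is_diff_expR (f df : V -> R) (a : V) :
  is_diff a f df ->
  is_diff a (fun v => expR (f v)) (fun v => expR (f a) * df v).
Proof.
move=> fdf; pose c := expR (f a).
have expd : is_diff (f a) (expR : R -> R) (fun h => h * c).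
  have dexp : derivable (expR : R -> R) (f a) 1 by [].
  apply: DiffDef; first exact/derivable1_diffP.
  by rewrite deriv1E// derive1E derive_val.
under [X in is_diff _ _ X]eq_fun do rewrite mulrC.
exact: (is_diff_comp fdf expd).
Qed.

(** The quotient rule at a point where the denominator is [1], the value taken
    by the normalizing denominators of the exponential maps. *)
Lemma is_diff_div1 (f g df dg : V -> R) (a : V) :
  is_diff a f df -> is_diff a g dg -> g a = 1 ->
  is_diff a (fun v => f v / g v) (fun v => df v - f a * dg v).
Proof.
move=> fdf gdg ga1.
have ga0 : g a != 0 by rewrite ga1 oner_neq0.
have gV : is_diff a (fun v => (g v)^-1) (- dg).
  have gd := ex_diff (is_diff_def := gdg).
  apply: DiffDef; first exact: differentiableV.
  rewrite diffV// diff_val ga1 expr1n invr1; apply/funext => v /=.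
  by rewrite scaleN1r.
have := is_diffM fdf gV.
rewrite ga1 invr1 scale1r => /is_diff_eq; apply.
apply/funext => v; rewrite -[LHS]/(f a * - dg v + df v).
by rewrite mulrN addrC.
Qed.

End Differentials.

Section Exponential.
Context {R : realType} {n : nat}.

(** A coordinate is linear, and bounded because the norm is the sup norm. *)
Lemma is_diff_tangent_coord (M : emanifold) (i : 'I_n) (a : tangent R n M) :
  is_diff a (fun v : tangent R n M => v 0 i) (fun v => v 0 i).
Proof.
pose f : tangent R n M -> R := fun v => v 0 i.
have fL : linear f by move=> k u v; rewrite /f /= !mxE.
pose fl : {linear tangent R n M -> R} :=
  HB.pack f (GRing.isLinear.Build R _ _ _ f fL).
have fc : continuous fl.
  apply: bounded_linear_continuous.
  apply/linear_boundedP; exists 1; split => // k k1 v.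
  apply: (@le_trans _ _ `|v|).
    rewrite [leRHS]/Num.Def.normr/= /tangent_norm [leRHS]/Num.Def.normr/=.
    rewrite mx_normrE; exact: (le_bigmax _ _ (0, i)).
  by rewrite ler_peMl// ltW.
rewrite -/f -[f]/(fl : _ -> _).
by apply: DiffDef; [exact: linear_differentiable|exact: diff_lin].
Qed.

(** The chain rule leaves the factor [exp (v_i / c)], which is [1] at
    [v = 0]. *)
Lemma is_diff_scaled_exp (M : emanifold) (b c : R) (i : 'I_n) :
  is_diff (0 : tangent R n M)
    (fun v : tangent R n M => b * expR (v 0 i / c))
    (fun v : tangent R n M => b * (v 0 i / c)).
Proof.
have vc : is_diff (0 : tangent R n M) (fun v : tangent R n M => v 0 i / c)
    (fun v : tangent R n M => v 0 i / c).
  under eq_fun do rewrite mulrC.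
  exact: (is_diffZ c^-1 (is_diff_tangent_coord i (0 : tangent R n M))).
have := is_diffZ b (is_diff_expR vc).
move=> /is_diff_eq; apply; apply/funext => v.
by rewrite !fctE /= mxE mul0r expR0 mul1r.
Qed.

Lemma dotv_one (x : 'rV[R]_n) : dotv ones x = \sum_i x 0 i.
Proof. by apply: eq_bigr => i _; rewrite mxE mul1r. Qed.

Lemma eExp_points (M : emanifold) (x : 'rV[R]_n) (v : tangent R n M) :
  points M x -> points M (eExp M x v).
Proof.
case: M v => v /=.
- by move=> x0 i; rewrite mxE mulr_gt0// expR_gt0.
- move=> x01 i; have /andP[x0 x1] := x01 i; rewrite !mxE.
  set e := expR _; have xe0 : 0 < x 0 i * e by exact: mulr_gt0 x0 (expR_gt0 _).
  have d0 : 0 < 1 - x 0 i + x 0 i * e by rewrite addr_gt0// subr_gt0.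
  by rewrite divr_gt0//= ltr_pdivrMr// mul1r ltrDr subr_gt0.
- move=> [x0 x1].
  set e : 'rV[R]_n := \row_i expR _.
  have xe0 i : 0 < x 0 i * e 0 i by rewrite mxE mulr_gt0 ?expR_gt0.
  have d0 : 0 < dotv x e.
    rewrite lt0r sumr_ge0 ?andbT => [|i _]; last exact: ltW.
    (* All terms are positive, so a zero sum means that there are no indices,
       against the coordinates of [x] having sum 1. *)
    apply/eqP => /psumr_eq0P xe; move: x1; rewrite /dotv big1 => [|i _].
      by move/esym/eqP; rewrite oner_eq0.
    by have := xe0 i; rewrite xe ?ltxx// => j _; exact: ltW.
  split=> [i|]; first by rewrite mxE divr_gt0.
  rewrite dotv_one; under eq_bigr do rewrite mxE.
  by rewrite -mulr_suml divff// gt_eqF.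
Qed.

Lemma eExp0 (M : emanifold) (x : 'rV[R]_n) :
  points M x -> eExp M x (0 : tangent R n M) = x.
Proof.
case: M => /= [_|_|[_ x1]]; apply/rowP => i; rewrite !mxE ?mul0r ?expR0 ?mulr1//.
  by rewrite subrK divr1.
rewrite /dotv; under eq_bigr do rewrite !mxE mul0r expR0 mulr1.
by rewrite -dotv_one x1 divr1.
Qed.

Lemma is_diff_eExp (M : emanifold) (x : 'rV[R]_n) :
  points M x ->
  is_diff (0 : tangent R n M) (eExp M x) (@tangent_val R n M).
Proof.
case: M => /= xM; apply: is_diff_row => i.
- have xi0 : x 0 i != 0 by rewrite gt_eqF.
  under eq_fun do rewrite mxE.
  apply: is_diff_eq (is_diff_scaled_exp Orthant (x 0 i) (x 0 i) i) _.
  by apply/funext => v; field.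
- have /andP[xi0 xi1] := xM i.
  have xn0 : x 0 i != 0 by rewrite gt_eqF.
  have xn1 : 1 - x 0 i != 0 by rewrite gt_eqF// subr_gt0.
  under eq_fun do rewrite !mxE.
  have num := is_diff_scaled_exp Box (x 0 i) (x 0 i * (1 - x 0 i)) i.
  have den := is_diffD (is_diff_cst (1 - x 0 i) 0) num.
  apply: is_diff_eq (is_diff_div1 num den _) _.
    by rewrite !fctE mxE mul0r expR0 mulr1 subrK.
  apply/funext => v; rewrite !fctE mxE mul0r expR0.
  rewrite -[X in _ * 1 * (X + _)]/(0 : R) add0r.
  by field; rewrite xn0 xn1.
- case: xM => x0 x1.
  have xn0 j : x 0 j != 0 by rewrite gt_eqF.
  have num := is_diff_scaled_exp Simplex (x 0 i) (x 0 i) i.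
  have den : is_diff (0 : tangent R n Simplex)
      (fun v => dotv x (\row_j expR (v 0 j / x 0 j))) (cst 0).
    rewrite /dotv; under eq_fun do under eq_bigr do rewrite mxE.
    (* The differential is the sum of the coordinates of [v], zero as [v] is
       tangent. *)
    apply: is_diff_eq (is_diff_bigsum _
      (fun j => is_diff_scaled_exp Simplex (x 0 j) (x 0 j) j)) _.
    apply/funext => v; have /eqP := tangent_valP v.
    rewrite dotv_one => v0; rewrite -[RHS]v0.
    by apply: eq_bigr => j _; field.
  under eq_fun do rewrite !mxE.
  apply: is_diff_eq (is_diff_div1 num den _) _.
    rewrite -x1 dotv_one; apply: eq_bigr => j _.
    by rewrite !mxE mul0r expR0 mulr1.
  by apply/funext => v; rewrite /= mulr0 subr0; field.
Qed.

End Exponential.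

Theorem lemma4p2 (R : realType) (n : nat) (M : emanifold) :
  is_retraction M (@eExp R n M).
Proof.
move=> x xM; have [dx dxE] := is_diff_eExp xM.
split=> [v||//|v]; [exact: eExp_points|exact: eExp0|by rewrite dxE].
Qed.
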